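(* Let $f,g:[0,1]\to[0,1]$ be given by $$f(x)=\begin{cases}3x & x\in[0,\frac13],\\ -x+\frac43 & x\in(\frac13,\frac23),\\ x & x\in[\frac23,1],\end{cases}\qquad g(x)=\begin{cases}x & x\in[0,\frac13],\\ -x+\frac23 & x\in(\frac13,\frac23),\\ 3x-2 & x\in[\frac23,1].\end{cases}$$ Then $\mu(f,g,p)=1$ for every $p\in(0,1)$, whereas $\mu(f,g,p)=0$ for $p\in\{0,1\}$.
   Context: For maps $f,g:[0,1]\to[0,1]$ and $p\in[0,1]$, consider the random dynamical system in which at each step, independently, $f$ is applied with probability $p$ and $g$ with probability $1-p$. Formally, $\Omega=\{f,g\}^{\infty}$ carries the product probability measure $P$ under which the coordinates $\omega_1,\omega_2,\ldots$ are independent with $P(\omega_i=f)=p$, $P(\omega_i=g)=1-p$. For $x\in[0,1]$ the trajectory is $x_0=x$, $x_n(\omega)=\omega_n\circ\omega_{n-1}\circ\cdots\circ\omega_1(x)$. For two starting points $x,y$ the trajectories $x_n$ and $y_n$ are driven by the same $\omega$. Define, for $n\ge 1$ and $t\in\mathbb{R}$, $$F_{xy}^{(n)}(t)=\frac1n\sum_{i=0}^{n-1}P(|x_i-y_i|<t),\quad F_{xy}(t)=\liminf_{n\to\infty}F_{xy}^{(n)}(t),\quad F_{xy}^\star(t)=\limsup_{n\to\infty}F_{xy}^{(n)}(t),$$ and the measure of (distributional) chaos $$\mu(f,g,p)=\sup_{x,y\in[0,1]}\int_0^{1}\bigl(F_{xy}^\star(t)-F_{xy}(t)\bigr)\,\mathrm{d}t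 .$$ For $p=1$ (resp. $p=0$) this is the measure of chaos of the deterministic system generated by $f$ (resp. $g$). *)

(* Defs.v *)
From HB Require Import structures.
From mathcomp Require Import all_boot all_order all_algebra.
From mathcomp Require Import all_classical all_reals all_analysis.
From mathcomp Require Import measurable_realfun ring lra.

Set Implicit Arguments.
Unset Strict Implicit.
Unset Printing Implicit Defensive.

Import Order.TTheory GRing.Theory Num.Theory.
Import numFieldNormedType.Exports.

Local Open Scope classical_set_scope.
Local Open Scope ring_scope.

(** A point of the noise space {f,g}^oo is coded by w : nat -> bool, where
    w n = true (resp. false) means that f (resp. g) is applied at step n.+1. *)
Definition coordinate_events : set (set (nat -> bool)) :=
  [set [set w : nat -> bool | w n] | n in [set: nat]].

(** nat -> bool with the product sigma-algebra. *)
Notation noise := (g_sigma_algebraType coordinate_events).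

Definition cylinder (n : nat) (b : nat -> bool) : set noise :=
  [set w : nat -> bool | forall i, (i < n)%N -> w i = b i].

(** P is the law of independent coordinates with P(w_i = true) = p, stated as
    the joint law of the first n coordinates, for every n. *)
Definition is_bernoulli_product (R : realType) (p : R)
    (P : probability noise R) : Prop :=
  forall (n : nat) (b : nat -> bool),
    P (cylinder n b) = (\prod_(i < n) (if b i then p else 1 - p))%:E.

Lemma measurable_cylinder n b : measurable (cylinder n b).
Proof.
rewrite (_ : cylinder n b = \bigcap_(i in [set i | (i < n)%N])
   (if b i then [set w : nat -> bool | w i]
    else ~` [set w : nat -> bool | w i])); last first.
  apply/seteqP; split => w /= H i ni.
    by rewrite /= -(H i ni); case: ifPn => // /negP.
  by move: (H i ni) => /=; case: ifP => //= _ /negP/negbTE.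
apply: bigcap_measurableType => i _.
have mi : measurable ([set w | w i] : set noise).
  by apply: sub_sigma_algebra; exists i.
by case: ifP => // _; exact: measurableC.
Qed.

(** Existence: partition [0,1] into two intervals of proportions p and 1 - p,
    iterate, and take the law of the address of a uniform point. *)
Section existence.
Context (R : realType) (p : R).

Fixpoint cell (u : R) (n : nat) : R * R :=
  if n is m.+1 then
    let c := cell u m in
    if u < c.1 + p * c.2 then (c.1, p * c.2)
    else (c.1 + p * c.2, (1 - p) * c.2)
  else (0, 1).

Definition address (u : measurableTypeR R) : noise :=
  fun n => (u : R) < (cell u n).1 + p * (cell u n).2.

Fixpoint word_cell (b : nat -> bool) (n : nat) : R * R :=
  if n is m.+1 then
    let c := word_cell b m in
    if b m then (c.1, p * c.2) else (c.1 + p * c.2, (1 - p) * c.2)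
  else (0, 1).

Lemma word_cell_len b n :
  (word_cell b n).2 = \prod_(i < n) (if b i then p else 1 - p).
Proof.
elim: n => [|n IHn] /=; first by rewrite big_ord0.
by rewrite big_ord_recr /= -IHn; case: (b n) => /=; rewrite mulrC.
Qed.

Lemma cell_word u b n : (forall i, (i < n)%N -> address u i = b i) ->
  cell u n = word_cell b n.
Proof.
elim: n => [//|n IHn] H /=.
have := H n (ltnSn n); rewrite /address => ->.
by rewrite IHn// => i ni; apply: H; rewrite ltnS ltnW.
Qed.

Lemma measurable_cell n :
  measurable_fun setT (fun u : R => (cell u n).1) /\
  measurable_fun setT (fun u : R => (cell u n).2).
Proof.
elim: n => [|n [m1 m2]] /=; first by split; exact: measurable_cst.
have mt : measurable_fun setT (fun u : R => (cell u n).1 + p * (cell u n).2).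
  by apply: measurable_funD => //; exact: measurable_funM.
have mb : measurable_fun setT (fun u : R => u < (cell u n).1 + p * (cell u n).2).
  by apply: measurable_fun_ltr => //; exact: measurable_id.
split.
- rewrite [X in measurable_fun _ X](_ : _ = fun u : R =>
    if u < (cell u n).1 + p * (cell u n).2 then (cell u n).1
    else (cell u n).1 + p * (cell u n).2); last by apply/funext => u; case: ifP.
  exact: measurable_fun_ifT.
- rewrite [X in measurable_fun _ X](_ : _ = fun u : R =>
    if u < (cell u n).1 + p * (cell u n).2 then p * (cell u n).2
    else (1 - p) * (cell u n).2); last by apply/funext => u; case: ifP.
  by apply: measurable_fun_ifT => //; apply: measurable_funM.
Qed.

Lemma measurable_address : measurable_fun setT address.
Proof.
apply: (@measurability _ _ (measurableTypeR R) noise setT address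
  coordinate_events) => //.
move=> _ [_ [n _ <-]] <-; rewrite setTI.
rewrite [X in measurable X](_ : _ = [set: R] `&`
  (fun u : R => u < (cell u n).1 + p * (cell u n).2) @^-1` [set true]); last first.
  by rewrite setTI.
have [m1 m2] := measurable_cell n.
apply: (_ : measurable_fun setT _) => //.
apply: measurable_fun_ltr => //.
by apply: measurable_funD => //; exact: measurable_funM.
Qed.

HB.instance Definition _ :=
  isMeasurableFun.Build _ _ _ _ address measurable_address.

Hypothesis p01 : 0 <= p <= 1.

Lemma word_cell_sub b n :
  0 <= (word_cell b n).1 /\ 0 <= (word_cell b n).2 /\
  (word_cell b n).1 + (word_cell b n).2 <= 1.
Proof.
have /andP[p0 p1] := p01.
elim: n => [|n [h1 [h2 h3]]] /=; first by rewrite add0r.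
have := mulr_ge0 p0 h2; have := @mulr_ge0 _ (1 - p) _ _ h2.
rewrite subr_ge0 => /(_ p1) H1 H2.
by case: (b n) => /=; (do ?split) => //; lra.
Qed.

Lemma address_cell u b n : (word_cell b n).1 <= u ->
  u < (word_cell b n).1 + (word_cell b n).2 ->
  forall i, (i < n)%N -> address u i = b i.
Proof.
have /andP[p0 p1] := p01.
elim: n => [//|n IHn] /= H1 H2.
have [h1 [h2 h3]] := word_cell_sub b n.
have H3 := mulr_ge0 p0 h2.
have H4 : 0 <= (1 - p) * (word_cell b n).2 by apply: mulr_ge0 => //; lra.
have A i : (i < n)%N -> address u i = b i.
  by apply: IHn; move: H1 H2; case: (b n) => /= *; lra.
move=> i; rewrite ltnS leq_eqVlt => /orP[/eqP ->|]; last exact: A.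
rewrite /address (cell_word A).
move: H1 H2; case: (b n) => /= H1 H2; first by [].
by apply/negbTE; rewrite -leNgt.
Qed.

Lemma cell_address u n : 0 <= u <= 1 ->
  (cell u n).1 <= u <= (cell u n).1 + (cell u n).2.
Proof.
move=> u01; elim: n => [|n /andP[h1 h2]] /=; first by rewrite add0r.
by case: ltP => /= h3; apply/andP; split => //; lra.
Qed.

Lemma uniform_prob01E (A : set R) : measurable A ->
  uniform_prob (@ltr01 R) A = lebesgue_measure (A `&` `[0, 1]).
Proof.
move=> mA; rewrite /uniform_prob integral_uniform_pdf.
rewrite (eq_integral (cst 1%E)); last first.
  move=> x; rewrite inE /= => -[_]; rewrite in_itv/= => x01.
  by rewrite /uniform_pdf x01 subr0 invr1.
by rewrite integral_cst ?mul1e//; exact: measurableI.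
Qed.

End existence.

Lemma exists_bernoulli_product (R : realType) (p : R) :
  exists P : probability noise R, 0 <= p <= 1 -> is_bernoulli_product p P.
Proof.
exists (distribution (uniform_prob (@ltr01 R)) (address p)) => p01 n b.
rewrite -(word_cell_len p) /distribution /= /pushforward.
have mB : measurable (address p @^-1` cylinder n b).
  rewrite -[X in measurable X]setTI.
  exact: (measurable_address p measurableT (measurable_cylinder n b)).
rewrite [LHS]uniform_prob01E//.
have [h1 [h2 h3]] := word_cell_sub p01 b n.
have memB u : (cylinder n b) (address p u) ->
    cell p u n = word_cell p b n by exact: cell_word.
have memA u := @address_cell R p p01 u b n.
set a := (word_cell p b n).1 in h1 h3 memA *.
set l := (word_cell p b n).2 in h2 h3 memA *.
have len (i := `[a, a + l[) (j := `[a, a + l]) :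
    lebesgue_measure [set` i] = l%:E /\ lebesgue_measure [set` j] = l%:E.
  rewrite !lebesgue_measure_itv/= !lte_fin ltrDl lt_neqAle h2 andbT.
  case: eqVneq => [<-//|_] /=.
  by rewrite -EFinD addrAC subrr add0r.
apply/eqP; rewrite eq_le; apply/andP; split.
- rewrite -len.2; apply: le_measure; rewrite ?inE//; first exact: measurableI.
  move=> u [/memB Bu] /=; rewrite !in_itv/= => u01.
  by have := cell_address p n u01; rewrite Bu.
- rewrite -len.1; apply: le_measure; rewrite ?inE//; first exact: measurableI.
  move=> u /=; rewrite !in_itv/= => /andP[u1 u2]; split; first exact: memA.
  by apply/andP; split; lra.
Qed.

Lemma is_bernoulli_product_unique (R : realType) (p : R)
    (P Q : probability noise R) :
  is_bernoulli_product p P -> is_bernoulli_product p Q ->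
  forall A, measurable A -> P A = Q A.
Proof.
move=> Pp Qp.
pose G : set (set noise) := [set A | A = set0 \/ exists n b, A = cylinder n b].
apply: (measure_unique G (fun=> setT)).
- apply/seteqP; split; last first.
    apply: smallest_sub; first exact: sigma_algebra_measurable.
    move=> _ [->|[n [b ->]]]; [exact: measurable0|exact: measurable_cylinder].
  apply: smallest_sub; first exact: smallest_sigma_algebra.
  move=> _ [n _ <-].
  have -> : [set w : nat -> bool | w n] =
      \bigcup_(t in [set t : n.+1.-tuple bool | nth false t n])
        cylinder n.+1 (nth false t).
    apply/seteqP; split => [w /= wn|w [t /= tn] /(_ n (ltnSn n)) ->//].
    have wE i (ni : (i < n.+1)%N) : nth false [tuple w i | i < n.+1] i = w i.
      by have := tnth_nth false [tuple w i | i < n.+1] (Ordinal ni);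
        rewrite tnth_mktuple.
    by exists [tuple w i | i < n.+1] => [|i ni]; rewrite /= wE.
  apply: (@fin_bigcup_measurable _ (g_sigma_algebraType G)) => [|t _].
    exact: finite_finset.
  by apply: sub_sigma_algebra; right; exists n.+1, (nth false t).
- move=> A B [->|[n [b ->]]]; first by left; rewrite set0I.
  case=> [->|[m [c ->]]]; first by left; rewrite setI0.
  wlog nm : n m b c / (n <= m)%N => [H|].
    by case: (leqP n m) => [/H//|/ltnW /H]; rewrite setIC.
  have [E|E] := pselect (forall i, (i < n)%N -> c i = b i).
    right; exists m, c; apply/seteqP; split => [w []//|w wc]; split => // i ni.
    by rewrite wc ?E// (leq_trans ni nm).
  left; apply/seteqP; split => // w [wb wc]; apply: E => i ni.
  by rewrite -wb// wc// (leq_trans ni nm).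
- by move=> _; right; exists 0%N, xpredT; apply/seteqP; split.
- by rewrite bigcup_const//; exists 0%N.
- by move=> A [->|[n [b ->]]]; [rewrite !measure0|exact: etrans (Pp n b) (esym (Qp n b))].
- by move=> k; apply: le_lt_trans (probability_le1 P measurableT) (ltry 1).
Qed.

(** The product measure, determined uniquely on measurable sets by the next lemma
    and [is_bernoulli_product_unique]; unspecified for p outside [0,1]. *)
Definition bernoulli_product (R : realType) (p : R) : probability noise R :=
  projT1 (cid (exists_bernoulli_product p)).

Lemma bernoulli_productP (R : realType) (p : R) :
  0 <= p <= 1 -> is_bernoulli_product p (bernoulli_product p).
Proof. exact: projT2 (cid (exists_bernoulli_product p)). Qed.

Section chaos.
Context (R : realType) (f g : R -> R).

(** Only the restrictions of f and g to [0,1] matter below. *)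
Fixpoint trajectory (w : nat -> bool) (x : R) (n : nat) : R :=
  if n is m.+1 then (if w m then f else g) (trajectory w x m) else x.

Local Open Scope ereal_scope.

(** The term n = 0 is a junk value, which the limits in n do not see. *)
Definition distance_distribution (p x y : R) (n : nat) (t : R) : \bar R :=
  (n%:R^-1)%:E * \sum_(i < n)
    bernoulli_product p
      [set w : nat -> bool | (`|trajectory w x i - trajectory w y i| < t)%R].

Definition lower_distribution (p x y t : R) : \bar R :=
  limn_einf (fun n => distance_distribution p x y n t).

Definition upper_distribution (p x y t : R) : \bar R :=
  limn_esup (fun n => distance_distribution p x y n t).

Definition measure_of_chaos (p : R) : \bar R :=
  ereal_sup [set r | exists x y : R,
    [/\ (0 <= x <= 1)%R, (0 <= y <= 1)%R &
        r = \int[lebesgue_measure]_(t in `[0%R, 1%R])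
              (upper_distribution p x y t - lower_distribution p x y t)]].

End chaos.

Definition fun_f (R : realType) (x : R) : R :=
  if x <= 1 / 3 then 3 * x
  else if x < 2 / 3 then - x + 4 / 3
  else x.

Definition fun_g (R : realType) (x : R) : R :=
  if x <= 1 / 3 then x
  else if x < 2 / 3 then - x + 2 / 3
  else 3 * x - 2.

Lemma fun_f01 (R : realType) (x : R) : 0 <= x <= 1 -> 0 <= fun_f x <= 1.
Proof.
move=> /andP[x0 x1]; rewrite /fun_f.
by case: (leP x) => h; last case: ltP => h'; apply/andP; split; lra.
Qed.

Lemma fun_g01 (R : realType) (x : R) : 0 <= x <= 1 -> 0 <= fun_g x <= 1.
Proof.
move=> /andP[x0 x1]; rewrite /fun_g.
by case: (leP x) => h; last case: ltP => h'; apply/andP; split; lra.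
Qed.

(* Main.v *)
Require Import Defs.
From mathcomp Require Import all_boot all_order all_algebra.
From mathcomp Require Import all_classical all_reals all_analysis.
From mathcomp Require Import measurable_realfun ring lra zify.

(** For p in (0,1), take y = 0, which both maps fix, and let x have ternary
    expansion with digits 0 and 2 only, in long alternating blocks. If the first
    digit of a point is 0, then g fixes it and f shifts its expansion; if it is
    2, then f fixes it and g shifts. Hence the trajectory of x runs through the
    shifts of x in order, only the speed being random, and no step takes longer
    than a geometric time. When the blocks grow doubly exponentially, each block
    of zeros (twos) outweighs all the past, so that for almost all times of a
    long initial segment x_i is near 0 (near 1) with high probability: the upper
    distribution is 1 and the lower one 0 on (0,1). For p in {0,1} every
    trajectory is eventually constant. *)

Set Implicit Arguments.
Unset Strict Implicit.
Unset Printing Implicit Defensive.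

Import Order.TTheory GRing.Theory Num.Theory.
Import numFieldNormedType.Exports.
Local Open Scope classical_set_scope.
Local Open Scope ring_scope.

(** * Events determined by finitely many coordinates *)

Section determined_events.

(** The premise is symmetric in [w] and [w'], so the one-way implication suffices. *)
Definition determined (n : nat) (A : set noise) : Prop :=
  forall w w' : nat -> bool, (forall i, (i < n)%N -> w i = w' i) -> A w -> A w'.

Definition override (b : nat -> bool) (n : nat) (c : bool) : nat -> bool :=
  fun i => if i == n then c else b i.

Lemma cylinderS n b : cylinder n b =
  cylinder n.+1 (override b n true) `|` cylinder n.+1 (override b n false).
Proof.
apply/seteqP; split => [w wb|w].
  have H : cylinder n.+1 (override b n (w n)) w.
    move=> i; rewrite ltnS leq_eqVlt /override => /orP[/eqP ->|ni]; rewrite ?eqxx//.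
    by rewrite ltn_eqF// wb.
  by case: (w n) H => H; [left|right].
move=> H i ni; case: H => /(_ i (ltnW ni)); rewrite /override ltn_eqF//.
Qed.

Lemma cylinder_override_disj n b :
  cylinder n.+1 (override b n true) `&` cylinder n.+1 (override b n false) = set0.
Proof.
apply/seteqP; split => // w [/(_ n (ltnSn n)) + /(_ n (ltnSn n))].
by rewrite /override eqxx => ->.
Qed.

(** Induction on the number [m] of free coordinates: the cylinder is split until it has length [n],
    where it lies in [A] or misses it. *)
Lemma determined_measurableI n m k A b : determined n A -> n = (k + m)%N ->
  measurable (A `&` cylinder k b).
Proof.
move=> dA; elim: m k b => [|m IHm] k b nkm.
  rewrite addn0 in nkm; subst k.
  have [Ab|Ab] := pselect (A b).
    rewrite (_ : _ `&` _ = cylinder n b); first exact: measurable_cylinder.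
    apply/seteqP; split => [w []//|w wb]; split => //.
    by apply: dA Ab => i ni; rewrite wb.
  rewrite (_ : _ `&` _ = set0); first exact: measurable0.
  by apply/seteqP; split => // w [Aw wb]; apply: Ab; apply: dA Aw => i ni; rewrite wb.
by rewrite cylinderS setIUr; apply: measurableU; apply: IHm; rewrite addSnnS.
Qed.

Lemma determined_measurable n A : determined n A -> measurable A.
Proof.
move=> dA; have := @determined_measurableI n n 0 A xpredT dA (esym (add0n n)).
by rewrite (_ : cylinder 0 _ = setT) ?setIT//; apply/seteqP; split.
Qed.

End determined_events.

(** * Speed along the tracked orbit *)

Section progress.
Context (s : nat -> bool).

(* Among the two maps, the one indexed by [s N] fixes the N-th point of the
   tracked orbit, the other one moves it to the next point. *)
Fixpoint progress (w : nat -> bool) (n : nat) : nat :=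
  if n is m.+1 then (progress w m + (w m != s (progress w m)))%N else 0%N.

Lemma progress_le w n : (progress w n <= n)%N.
Proof.
by elim: n => //= n IHn; rewrite -addn1 leq_add// leq_b1.
Qed.

Lemma eq_progress n w w' : (forall i, (i < n)%N -> w i = w' i) ->
  progress w n = progress w' n.
Proof.
elim: n => //= n IHn H; rewrite IHn ?H// => i ni; exact/H/ltnW.
Qed.

Context (R : realType) (p q : R) (P : probability noise R).
Context (p01 : 0 <= p <= 1) (qp : q <= p) (qp' : q <= 1 - p).
Context (PP : is_bernoulli_product p P).

(** The probability of [cylinder n b]. *)
Definition weight (b : nat -> bool) n : R := \prod_(i < n) (if b i then p else 1 - p).

Lemma weight_ge0 b n : 0 <= weight b n.
Proof. by apply: prodr_ge0 => i _; have /andP[p0 p1] := p01; case: ifP => _; lra. Qed.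

Lemma weight_override b n c :
  weight (override b n c) n.+1 = weight b n * (if c then p else 1 - p).
Proof.
rewrite /weight big_ord_recr /= /override eqxx; congr (_ * _).
by apply: eq_bigr => i _; rewrite ltn_eqF.
Qed.

Lemma progress_override b k c : progress (override b k c) k = progress b k.
Proof. by apply: eq_progress => i ik; rewrite /override ltn_eqF. Qed.

Lemma determined_progress n (A : pred nat) :
  determined n [set w | A (progress w n)].
Proof. by move=> w w' /eq_progress /= ->. Qed.

(* Markov's inequality for 2^-progress, whose conditional expectation shrinks by
   a factor at most 1 - q / 2 at each step; cylinders play the role of the past. *)
Lemma progress_tailI K n m k b : n = (k + m)%N ->
  (P ([set w | (progress w n < K)%N] `&` cylinder k b) <=
   (weight b k * 2 ^+ K * 2^-1 ^+ progress b k * (1 - q / 2) ^+ m)%:E)%E.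
Proof.
have /andP[p0 p1] := p01; have [qp1 qp2] := (qp, qp').
have r0 : 0 <= 1 - q / 2 by lra.
elim: m k b => [|m IHm] k b nkm.
  (* All [n] coordinates are fixed, so the event is empty or the whole cylinder; in the latter case
     [2 ^ (K - progress)] is at least 1. *)
  rewrite addn0 in nkm; subst k; rewrite expr0 mulr1.
  case: (ltnP (progress b n) K) => Kb; last first.
    rewrite (_ : _ `&` _ = set0).
      rewrite measure0 lee_fin !mulr_ge0// ?weight_ge0// exprn_ge0//.
    apply/seteqP; split => // w [/= + /eq_progress H]; rewrite H.
    by rewrite ltnNge Kb.
  apply: (@le_trans _ _ (P (cylinder n b))).
    apply: le_measure; rewrite ?inE.
    - exact: (@determined_measurableI n 0 n _ b (@determined_progress n (fun N => (N < K)%N)) (esym (addn0 n))).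
    - exact: measurable_cylinder.
    - exact: subIsetr.
  rewrite PP lee_fin -mulrA -/(weight b n) ler_peMr ?weight_ge0//.
  rewrite exprVn -expfB// exprn_ege1//; lra.
have nkm' : n = (k.+1 + m)%N by rewrite addSnnS.
rewrite cylinderS setIUr measureU; last 3 first.
- apply: determined_measurableI (@determined_progress n (fun N => (N < K)%N)) nkm'.
- apply: determined_measurableI (@determined_progress n (fun N => (N < K)%N)) nkm'.
- by rewrite setIACA cylinder_override_disj setI0.
apply: (le_trans (leeD (IHm _ _ nkm') (IHm _ _ nkm'))).
rewrite -EFinD lee_fin !weight_override /= !progress_override.
rewrite /override eqxx !exprD exprS.
set z := weight b k; set u := 2 ^+ K; set v := _ ^+ progress b k.
set r := _ ^+ m.
have H : 0 <= z * u * v * r.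
  by rewrite !mulr_ge0// ?weight_ge0// exprn_ge0.
set h := s _.
(* The map indexed by [h] leaves progress unchanged, the other one halves 2^-progress; the latter
   has probability at least [q]. *)
suff : z * u * v * r *
  (p * 2^-1 ^+ (true != h) + (1 - p) * 2^-1 ^+ (false != h)) <=
    z * u * v * r * (1 - q / 2).
  by congr (_ <= _); ring.
apply: ler_wpM2l => //.
by case: h => /=; rewrite ?expr0 ?expr1; lra.
Qed.

Lemma progress_tail K n :
  (P [set w | (progress w n < K)%N] <= (2 ^+ K * (1 - q / 2) ^+ n)%:E)%E.
Proof.
have := @progress_tailI K n n 0 xpredT (esym (add0n n)).
rewrite (_ : cylinder 0 _ = setT); last by apply/seteqP; split.
by rewrite setIT /weight big_ord0 mul1r expr0 mulr1.
Qed.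

End progress.

(** * Bounds on upper and lower limits, and monotonicity of the integral *)

Section limn_esup_bounds.
Context (R : realType).
Implicit Types (u : (\bar R)^nat) (c : \bar R).
Local Open Scope ereal_scope.

Lemma limn_esup_ge u c :
  (forall n, exists2 m, (n <= m)%N & c <= u m) -> c <= limn_esup u.
Proof.
move=> cu; rewrite limn_esup_lim; apply: lime_ge; first exact: is_cvg_esups.
near=> n; have [m nm cm] := cu n; apply: (le_trans cm).
by apply: ereal_sup_ubound; exists m.
Unshelve. all: by end_near. Qed.

Lemma limn_esup_le u c : (forall n, u n <= c) -> limn_esup u <= c.
Proof.
move=> uc; rewrite limn_esup_lim; apply: lime_le; first exact: is_cvg_esups.
by near=> n; apply: ge_ereal_sup => _ [m _ <-].
Unshelve. all: by end_near. Qed.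

Lemma limn_einf_le u c :
  (forall n, exists2 m, (n <= m)%N & u m <= c) -> limn_einf u <= c.
Proof.
move=> cu; rewrite /limn_einf leeNl; apply: limn_esup_ge => n.
by have [m nm um] := cu n; exists m => //; rewrite leeN2.
Qed.

Lemma limn_einf_ge u c : (forall n, c <= u n) -> c <= limn_einf u.
Proof.
by move=> uc; rewrite /limn_einf leeNr; apply: limn_esup_le => n; rewrite leeN2.
Qed.

End limn_esup_bounds.

(* [ge0_le_integral] without its measurability assumptions. *)
Lemma le_integral_nonneg d (T : measurableType d) (R : realType)
  (mu : {measure set T -> \bar R}) (D : set T) (f g : T -> \bar R) :
  (forall x, D x -> (0 <= f x)%E) -> (forall x, D x -> (f x <= g x)%E) ->
  (\int[mu]_(x in D) f x <= \int[mu]_(x in D) g x)%E.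
Proof.
move=> f0 fg; have g0 x : D x -> (0 <= g x)%E.
  by move=> Dx; apply: le_trans (fg x Dx); exact: f0.
rewrite !ge0_integralE//; apply: ereal_sup_le => _ [h hf <-].
exists h => // x; apply: (le_trans (hf x)); rewrite /patch.
by case: ifPn => // /set_mem; exact: fg.
Qed.

(** * Averages of sequences that are small after an initial stretch *)

Section averages.
Context (R : realType).

Lemma sum_le_head_tail (a : nat -> R) (d n : nat) (e : R) : 0 <= e ->
  (forall i, a i <= 1) -> (forall i, (d <= i < n)%N -> a i <= e) ->
  \sum_(i < n) a i <= (minn n d)%:R + n%:R * e.
Proof.
move=> e0 a1; elim: n => [|n IHn] ae.
  by rewrite big_ord0 min0n mul0r addr0.
rewrite big_ord_recr /=.
have {}IHn : \sum_(i < n) a i <= (minn n d)%:R + n%:R * e.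
  by apply: IHn => i /andP[di ni]; apply: ae; rewrite di ltnW.
have [nd|dn] := ltnP n d.
  rewrite (minn_idPl nd); rewrite (minn_idPl (ltnW nd)) in IHn.
  rewrite -natr1; have := a1 n; lra.
rewrite (minn_idPr dn) in IHn; rewrite (minn_idPr (leqW dn)) -natr1.
have := ae n; rewrite dn ltnSn => /(_ isT); lra.
Qed.

(** The head contributes at most [c * L] and the tail at most [L.-1]. For fixed [c] the bound tends
    to 0 as [L] grows. *)
Lemma mean_le (a : nat -> R) (c L : nat) : (1 < L)%N ->
  (forall i, a i <= 1) ->
  (forall i, (c * L <= i < L * L.-1)%N -> a i <= L%:R^-1) ->
  (L * L.-1)%:R^-1 * \sum_(i < (L * L.-1)%N) a i <= c.+1%:R / L.-1%:R.
Proof.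
move=> L1 a1 aL; have L0 : (0 < L%:R :> R) by rewrite ltr0n ltnW.
have M0 : (0 < L.-1%:R :> R) by rewrite ltr0n; lia.
have e0 : 0 <= L%:R^-1 :> R by rewrite invr_ge0 ltW.
have := sum_le_head_tail e0 a1 aL.
set S := \sum_(i < _) _ => HS.
have {}HS : S <= c.+1%:R * L%:R.
  apply: (le_trans HS); rewrite -natr1 mulrDl mul1r; apply: lerD.
    by rewrite -natrM ler_nat geq_minr.
  by rewrite natrM mulrAC mulfV ?gt_eqF// mul1r ler_nat leq_pred.
rewrite mulrC ler_pdivrMr ?natrM ?mulr_gt0//.
rewrite (_ : _ / _ * _ = c.+1%:R * L%:R)//.
by field; rewrite gt_eqF.
Qed.

End averages.

(** * Cantor set points with prescribed ternary digits *)

Section cantor_point.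
Context (R : realType) (s : nat -> bool).

(** Ternary expansion cut after [m] digits, read from position [n] on; the digit is 2 where [s]
    holds and 0 elsewhere. *)
Fixpoint cantor_approx (m n : nat) : R :=
  if m is k.+1 then ((if s n then 2 else 0) + cantor_approx k n.+1) / 3 else 0.

Lemma cantor_approx01 m n : 0 <= cantor_approx m n <= 1.
Proof.
elim: m n => [|m IHm] n /=; first by rewrite lexx ler01.
by have /andP[? ?] := IHm n.+1; case: (s n); apply/andP; split; lra.
Qed.

Lemma cantor_approx_nd n : nondecreasing_seq (cantor_approx ^~ n).
Proof.
apply/nondecreasing_seqP => m; elim: m n => [|m IHm] n.
  by have /andP[] := cantor_approx01 1 n.
by have := IHm n.+1; rewrite /=; lra.
Qed.

Definition cantor_pt (n : nat) : R := limn (cantor_approx ^~ n).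

Lemma cantor_approx_cvg n : cantor_approx ^~ n @ \oo --> cantor_pt n.
Proof.
apply: nondecreasing_is_cvgn; first exact: cantor_approx_nd.
by exists 1 => _ [m _ <-]; have /andP[] := cantor_approx01 m n.
Qed.

Lemma cantor_ptE n : cantor_pt n = ((if s n then 2 else 0) + cantor_pt n.+1) / 3.
Proof.
have C : (fun m => cantor_approx m.+1 n) @ \oo -->
    ((if s n then 2 else 0) + cantor_pt n.+1) / 3.
  apply: cvgMl; apply: cvgD; first exact: cvg_cst.
  exact: cantor_approx_cvg.
rewrite -(cvg_lim (@Rhausdorff R) C).
apply/esym/cvg_lim => //.
by rewrite (cvg_shiftS (cantor_approx ^~ n)); exact: cantor_approx_cvg.
Qed.

Lemma cantor_pt01 n : 0 <= cantor_pt n <= 1.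
Proof.
apply/andP; split; [apply: limr_ge|apply: limr_le];
  do ?[exact: cantor_approx_cvg | exact: (cvgP _ (cantor_approx_cvg n))];
  by near=> m; have /andP[] := cantor_approx01 m n.
Unshelve. all: by end_near. Qed.

(** Each leading digit 0 divides the point by 3, and no point exceeds 1. *)
Lemma cantor_pt_near0 m n : (forall i, (n <= i < n + m)%N -> s i = false) ->
  cantor_pt n <= 3^-1 ^+ m.
Proof.
elim: m n => [|m IHm] n H; first by have /andP[] := cantor_pt01 n.
rewrite cantor_ptE H; last by lia.
have : cantor_pt n.+1 <= 3^-1 ^+ m by apply: IHm => i ?; apply: H; lia.
by rewrite exprS; lra.
Qed.

Lemma cantor_pt_near1 m n : (forall i, (n <= i < n + m)%N -> s i = true) ->
  1 - 3^-1 ^+ m <= cantor_pt n.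
Proof.
elim: m n => [|m IHm] n H; first by have /andP[] := cantor_pt01 n; rewrite expr0; lra.
rewrite cantor_ptE H; last by lia.
have : 1 - 3^-1 ^+ m <= cantor_pt n.+1 by apply: IHm => i ?; apply: H; lia.
by rewrite exprS; lra.
Qed.

(** Digit 0 puts the point in [0,1/3], digit 2 in [2/3,1]; there one map is the identity and the
    other deletes the digit, so the middle branches never occur. *)
Lemma trajectory_cantor w n :
  trajectory (@fun_f R) (@fun_g R) w (cantor_pt 0) n = cantor_pt (progress s w n).
Proof.
elim: n => //= n ->; set N := progress s w n.
have /andP[h0 h1] := cantor_pt01 N.+1; have := cantor_ptE N.
case: (w n); case: (s N) => /= E; rewrite ?addn0 ?addn1 /fun_f /fun_g;
  case: leP => ?; try case: ltP => ?; try lra.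
Qed.

Lemma trajectory_fix0 w n : trajectory (@fun_f R) (@fun_g R) w 0 n = 0.
Proof.
elim: n => //= n ->; have h : 0 <= 1 / 3 :> R by lra.
by case: (w n); rewrite /fun_f /fun_g h ?mulr0.
Qed.

End cantor_point.

(* Constant on the blocks [2^2^j, 2^2^(j+1)) = [L, L^2), whose lengths dwarf
   everything that precedes them. *)
Definition phase (N : nat) : bool := odd (trunc_log 2 (trunc_log 2 N)).

(** The inner logarithm is at least [2 ^ j] and below [2 ^ j.+1], so the outer one is [j]. *)
Lemma phaseE j N : (2 ^ 2 ^ j <= N < 2 ^ 2 ^ j * 2 ^ 2 ^ j)%N -> phase N = odd j.
Proof.
move=> /andP[h1 h2]; congr odd; apply: trunc_log_eq => //; apply/andP; split.
  exact: trunc_log_max.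
rewrite -(@ltn_exp2l 2)//; apply: leq_ltn_trans (trunc_logP _ _) _ => //.
  by apply: leq_trans h1; rewrite expn_gt0.
by rewrite expnS mul2n -addnn expnD.
Qed.

(** * Distance distributions and the measure of chaos for general maps *)

Section distance_distribution.
Context (R : realType) (f g : R -> R) (p : R).

Definition close_event (x y : R) (i : nat) (t : R) : set noise :=
  [set w : nat -> bool | `|trajectory f g w x i - trajectory f g w y i| < t].

Lemma eq_trajectory x n (w w' : nat -> bool) :
  (forall i, (i < n)%N -> w i = w' i) ->
  trajectory f g w x n = trajectory f g w' x n.
Proof.
elim: n => //= n IHn H; rewrite H// IHn// => i ni; exact/H/ltnW.
Qed.

Lemma determined_close x y i t : determined i (close_event x y i t).
Proof.
move=> w w' ww'; rewrite /close_event /=.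
by rewrite (eq_trajectory x ww') (eq_trajectory y ww').
Qed.

Lemma measurable_close x y i t : measurable (close_event x y i t).
Proof. exact: determined_measurable (@determined_close x y i t). Qed.

(** Real-valued, so that averages and Cesàro limits are taken in [R]. *)
Definition close_prob (x y t : R) (i : nat) : R :=
  fine (bernoulli_product p (close_event x y i t)).

Lemma close_probE x y t i :
  bernoulli_product p (close_event x y i t) = (close_prob x y t i)%:E.
Proof.
by rewrite /close_prob fineK// fin_num_measure//; exact: measurable_close.
Qed.

Lemma close_prob01 x y t i : 0 <= close_prob x y t i <= 1.
Proof.
rewrite -!lee_fin -close_probE measure_ge0 probability_le1//.
exact: measurable_close.
Qed.

Lemma distance_distributionE x y n t : distance_distribution f g p x y n t =
  (n%:R^-1 * \sum_(i < n) close_prob x y t i)%:E.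
Proof.
rewrite /distance_distribution EFinM; congr (_ * _)%E; rewrite -sumEFin.
by apply: eq_bigr => i _; exact: close_probE.
Qed.

Lemma distance_distribution01 x y n t :
  (0 <= distance_distribution f g p x y n t <= 1)%E.
Proof.
rewrite distance_distributionE !lee_fin; apply/andP; split.
  rewrite mulr_ge0 ?invr_ge0// sumr_ge0// => i _.
  by have /andP[] := close_prob01 x y t i.
(* At [n = 0] the empty sum makes the mean 0. *)
case: n => [|n]; first by rewrite big_ord0 mulr0.
rewrite mulrC ler_pdivrMr// mul1r -[leRHS](_ : \sum_(i < n.+1) 1 = _).
  by apply: ler_sum => i _; have /andP[] := close_prob01 x y t i.
by rewrite sumr_const card_ord.
Qed.

Lemma chaos_integrand01 x y t : (0 <= upper_distribution f g p x y t -
  lower_distribution f g p x y t <= 1)%E.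
Proof.
have U1 : (upper_distribution f g p x y t <= 1)%E.
  by apply: limn_esup_le => n; have /andP[] := distance_distribution01 x y n t.
have L0 : (0 <= lower_distribution f g p x y t)%E.
  by apply: limn_einf_ge => n; have /andP[] := distance_distribution01 x y n t.
have LU := limn_einf_sup (fun n => distance_distribution f g p x y n t).
rewrite -/(lower_distribution f g p x y t) in LU.
rewrite -/(upper_distribution f g p x y t) in LU.
have Lf : lower_distribution f g p x y t \is a fin_num.
  by rewrite ge0_fin_numE// (le_lt_trans LU)// (le_lt_trans U1)// ltry.
rewrite sube_ge0 ?Lf// LU /=; apply: (le_trans (leeB U1 L0)).
by rewrite sube0.
Qed.

Lemma integral_cst1_01 :
  (\int[lebesgue_measure]_(t in `[0%R, 1%R]) (1 : \bar R) = 1)%E.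
Proof.
rewrite integral_cst//= lebesgue_measure_itv/= lte_fin ltr01 oppr0 adde0.
by rewrite mul1e.
Qed.

Lemma measure_of_chaos_le1 : (measure_of_chaos f g p <= 1)%E.
Proof.
apply: ge_ereal_sup => _ [x [y [_ _ ->]]].
rewrite -[leRHS]integral_cst1_01; apply: le_integral_nonneg => t _;
  by have /andP[] := chaos_integrand01 x y t.
Qed.

(** The two bounds force the integrand to be 1 on the open interval, and the endpoints are null; so
    this pair attains the general bound 1. *)
Lemma measure_of_chaos_eq1 (x y : R) : 0 <= x <= 1 -> 0 <= y <= 1 ->
  (forall t : R, 0 < t < 1 -> (1 <= upper_distribution f g p x y t)%E) ->
  (forall t : R, 0 < t < 1 -> (lower_distribution f g p x y t <= 0)%E) ->
  measure_of_chaos f g p = 1%E.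
Proof.
move=> x01 y01 U L; apply/eqP; rewrite eq_le measure_of_chaos_le1 /=.
apply: ereal_sup_ubound; exists x, y; split => //.
have E : {in `]0%R, 1%R[%classic : set R, cst 1%E =1 (fun t => upper_distribution f g p x y t -
    lower_distribution f g p x y t)%E}.
  move=> t /set_mem; rewrite /= in_itv/= => t01; apply/eqP; rewrite eq_le.
  have /andP[_ ->] := chaos_integrand01 x y t; rewrite andbT.
  by rewrite -[leLHS]sube0; apply: leeB; [exact: U|exact: L].
rewrite [RHS]integral_itv_bndoo; last first.
  have m1 : measurable_fun (`]0%R, 1%R[%classic : set R) (cst 1%E : R -> \bar R).
    exact: measurable_cst.
  exact: (eq_measurable_fun _ E m1).
rewrite -[LHS]integral_cst1_01 [LHS]integral_itv_bndoo; last exact: measurable_cst.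
by apply: eq_integral => t /E.
Qed.

(** By Cesàro, convergent probabilities have convergent means, so the upper and lower distributions
    coincide. *)
Lemma measure_of_chaos_eq0 :
  (forall x y t : R, 0 <= x <= 1 -> 0 <= y <= 1 ->
    exists l : R, close_prob x y t @ \oo --> l) ->
  measure_of_chaos f g p = 0%E.
Proof.
move=> H; rewrite /measure_of_chaos (_ : mkset _ = [set 0%E]) ?ereal_sup1//.
have I (x y : R) : 0 <= x <= 1 -> 0 <= y <= 1 -> 
   (\int[lebesgue_measure]_(t in `[0%R, 1%R])
    (upper_distribution f g p x y t - lower_distribution f g p x y t) = 0)%E.
  move=> x01 y01; apply: integral0_eq => t _.
  have [l /cesaro al] := H x y t x01 y01.
  have /cvg_limn_einf_sup[] :
      distance_distribution f g p x y ^~ t @ \oo --> l%:E.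
    (* [arithmetic_mean] at index [n] averages [n.+1] terms, hence the shift. *)
    rewrite -(cvg_shiftS (distance_distribution f g p x y ^~ t)) /=.
    apply/fine_cvgP; split.
      by near=> n; rewrite distance_distributionE.
    apply: cvg_trans al; apply: near_eq_cvg; near=> n.
    by rewrite /= distance_distributionE /= /arithmetic_mean /series /= big_mkord.
  by rewrite /upper_distribution /lower_distribution => -> ->; rewrite subee.
apply/seteqP; split => [_ [x [y [x01 y01 ->]]]|_ ->]; first exact: I.
(* A witness is needed: the supremum of the empty set would be -oo. *)
by exists 0, 0; rewrite lexx ler01; split => //; rewrite I// lexx ler01.
Unshelve. all: by end_near. Qed.

End distance_distribution.

(** * The deterministic systems, p = 0 and p = 1 *)

Section deterministic.
Context (R : realType).

Lemma trajectory_cst (f g : R -> R) (b : bool) x n :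
  trajectory f g (fun=> b) x n = iter n (if b then f else g) x.
Proof. by elim: n => //= n ->. Qed.

(** The cylinder around the constant noise has probability 1, so the event has probability 1 or 0
    according to whether it contains that noise. *)
Lemma close_prob_deterministic (f g : R -> R) (b : bool) x y t n :
  close_prob f g b%:R x y t n =
  (`|iter n (if b then f else g) x - iter n (if b then f else g) y| < t)%R%:R.
Proof.
set h := if b then f else g; pose P : probability noise R := bernoulli_product b%:R.
have b01 : 0 <= (b%:R : R) <= 1 by case: b @h @P => _ _; rewrite ?lexx ?ler01.
have Pc : P (cylinder n (fun=> b)) = 1%E.
  rewrite /P (bernoulli_productP b01) big1// => i _.
  by case: b {h P b01} => //=; rewrite subr0.
have dE := @determined_close R f g x y n t.
have mE := @measurable_close R f g x y n t.
have mc := measurable_cylinder n (fun=> b).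
rewrite /close_prob -/P.
have Eb : close_event f g x y n t (fun=> b) = (`|iter n h x - iter n h y| < t)%R.
  by rewrite /close_event /= !trajectory_cst.
case: ltP Eb => _ Eb.
  rewrite (_ : P _ = 1%E)//; apply/eqP; rewrite eq_le probability_le1//= -Pc.
  apply: le_measure; rewrite ?inE// => w wb.
  by apply: (dE (fun=> b)) => [i ni|]; [rewrite wb|rewrite Eb].
rewrite (_ : P _ = 0%E)//; apply/eqP; rewrite eq_le measure_ge0 andbT.
have <- : P (~` cylinder n (fun=> b)) = 0%E.
  by rewrite probability_setC// Pc subee.
apply: le_measure; rewrite ?inE//; first exact: measurableC.
move=> w Ew wb; suff : close_event f g x y n t (fun=> b) by rewrite Eb.
by apply: dE Ew => i ni; rewrite wb.
Qed.

Lemma measure_of_chaos_deterministic (f g : R -> R) (b : bool) :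
  (forall x, 0 <= x <= 1 -> exists n, let z := iter n (if b then f else g) x in
    (if b then f else g) z = z) ->
  measure_of_chaos f g b%:R = 0%E.
Proof.
set h := if b then f else g => H; apply: measure_of_chaos_eq0 => x y t x01 y01.
have {}H z : 0 <= z <= 1 -> exists (m : nat) (l : R), forall n, (m <= n)%N -> iter n h z = l.
  move=> /H[m hm]; exists m, (iter m h z) => n /subnK <-.
  by rewrite iterD; elim: (n - m)%N => //= k ->.
have [m [l ml]] := H _ x01; have [m' [l' ml']] := H _ y01.
exists (`|l - l'| < t)%R%:R; apply: cvg_near_cst; near=> n.
rewrite close_prob_deterministic -/h ml ?ml'//; near: n; exact: nbhs_infty_ge.
Unshelve. all: by end_near. Qed.

Lemma fun_f_id (x : R) : 2 / 3 <= x -> fun_f x = x.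
Proof. by move=> h; rewrite /fun_f; case: leP => ?; try case: ltP => ?; lra. Qed.

(** The conjugacy by x -> 1 - x, which carries results on [fun_f] over to [fun_g]. *)
Lemma fun_g_sym (x : R) : fun_g x = 1 - fun_f (1 - x).
Proof.
by rewrite /fun_f /fun_g; case: leP => ?; try case: ltP => ?;
  case: leP => ?; try case: ltP => ?; lra.
Qed.

(** Up to 1/3 the map triples; from (1/3,1] one step lands in [2/3,1], where every point is
    fixed. *)
Lemma fun_f_iter_large n (x : R) : 0 <= x <= 1 -> 1 / 3 <= 3 ^+ n * x ->
  2 / 3 <= iter n.+1 (@fun_f R) x.
Proof.
elim: n x => [|n IHn] x x01 h; have /andP[x0 x1] := x01.
  rewrite expr0 mul1r in h; rewrite /= /fun_f.
  by case: (leP x) => ?; last case: (ltP x) => ?; lra.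
have [xle|xgt] := leP x (1 / 3).
  rewrite iterSr; apply: IHn; first exact: fun_f01.
  by rewrite /fun_f xle mulrA -exprSr.
rewrite iterSr (_ : iter _ _ _ = fun_f x).
  by rewrite /fun_f; case: (leP x) => ?; last case: (ltP x) => ?; lra.
have : fun_f (fun_f x) = fun_f x.
  by apply: fun_f_id; rewrite /fun_f; case: (leP x) => ?; last case: (ltP x) => ?; lra.
by elim: n.+1 => //= k IHk E; rewrite IHk.
Qed.

Lemma fun_f_eventually_fixed (x : R) : 0 <= x <= 1 ->
  exists n, fun_f (iter n (@fun_f R) x) = iter n (@fun_f R) x.
Proof.
move=> x01; have /andP[x0 x1] := x01.
have [->|xn0] := eqVneq x 0.
  by exists 0%N; rewrite /= /fun_f ifT ?mulr0//; lra.
have xgt0 : 0 < x by rewrite lt_neqAle eq_sym xn0.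
(* With [n] above 1/x, [3 ^ n * x] exceeds 1. *)
pose n := Num.bound x^-1; exists n.+1; apply: fun_f_id.
apply: fun_f_iter_large => //.
have xn : x^-1 < n%:R by apply: archi_boundP; rewrite invr_ge0.
have n3 : n%:R <= 3 ^+ n :> R by rewrite -natrX ler_nat ltnW// ltn_expl.
have : 1 <= 3 ^+ n * x.
  by rewrite -ler_pdivrMr// div1r (le_trans (ltW xn)).
lra.
Qed.

Lemma fun_g_eventually_fixed (x : R) : 0 <= x <= 1 ->
  exists n, fun_g (iter n (@fun_g R) x) = iter n (@fun_g R) x.
Proof.
move=> x01; have [|n hn] := @fun_f_eventually_fixed (1 - x).
  by have /andP[? ?] := x01; apply/andP; split; lra.
have E k : iter k (@fun_g R) x = 1 - iter k (@fun_f R) (1 - x).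
  elim: k => [|k IHk] /=; first by rewrite subKr.
  by rewrite IHk fun_g_sym subKr.
by exists n; rewrite E fun_g_sym subKr hn.
Qed.

End deterministic.

(** * The random system, 0 < p < 1 *)

Section random.
Context (R : realType) (p : R).
Context (p01 : 0 < p < 1).

Let P := bernoulli_product p.
Let y0 : R := cantor_pt R phase 0.
Let a (t : R) := close_prob (@fun_f R) (@fun_g R) p y0 0 t.

(** Progress is at least linear with high probability. As [c] does not depend on [L], the waiting
    time [c * L] is negligible against [L * L.-1]. *)
Lemma progress_rate s : exists c, forall L i, (0 < L)%N -> (c * L <= i)%N ->
  (P [set w | (progress s w i < L)%N] <= (L%:R^-1)%:E)%E.
Proof.
have /andP[p0 p1] := p01; pose q := Num.min p (1 - p).
have q0 : 0 < q by rewrite lt_min p0 subr_gt0 p1.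
have qp : q <= p by rewrite ge_min lexx.
have qp' : q <= 1 - p by rewrite ge_min lexx orbT.
pose r := 1 - q / 2; have r0 : 0 <= r by rewrite /r; lra.
have r1 : r < 1 by rewrite /r; lra.
(* The value 1/4 beats the factor [2 ^ L] of the tail bound: what remains is 2^-L, at most 1/L. *)
have [c hc] : exists c, r ^+ c <= 4^-1.
  have : (fun n => r ^+ n) @ \oo --> 0 by apply: cvg_expr; rewrite ger0_norm.
  move=> /cvgrPdist_le /(_ 4^-1); rewrite invr_gt0 ltr0n => /(_ isT)[c _ /(_ c (leqnn c))].
  by rewrite /= sub0r normrN ger0_norm ?exprn_ge0// => ?; exists c.
exists c => L i L0 cLi.
have p01' : 0 <= p <= 1 by rewrite !ltW.
have := progress_tail s p01' qp qp' (bernoulli_productP p01') L i.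
move=> /le_trans; apply.
rewrite lee_fin -/r.
have : r ^+ i <= (4^-1) ^+ L.
  apply: (@le_trans _ _ (r ^+ (c * L))).
    by rewrite ler_wiXn2l// ltW.
  by rewrite exprM lerXn2r ?nnegrE ?exprn_ge0// invr_ge0.
move=> /(ler_wpM2l (_ : 0 <= 2 ^+ L)) H; apply: (le_trans (H _)).
  by rewrite exprn_ge0.
rewrite -exprMn (_ : 2 * 4^-1 = 2^-1 :> R); last by lra.
rewrite exprVn lef_pV2 ?posrE ?exprn_gt0 ?ltr0n// -natrX ler_nat.
by rewrite ltnW// ltn_expl.
Qed.

Lemma close_eventE t i : close_event (@fun_f R) (@fun_g R) y0 0 i t =
  [set w | cantor_pt R phase (progress phase w i) < t].
Proof.
apply/seteqP; split => w;
  rewrite /close_event /= trajectory_cantor trajectory_fix0 subr0 ger0_norm//;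
  by have /andP[] := cantor_pt01 R phase (progress phase w i).
Qed.

(** Progress is at most [i], so the [L] positions starting there end before [L * L], inside block
    [j]. *)
Lemma phase_window j i w k (L := (2 ^ 2 ^ j)%N) :
  (i < L * L.-1)%N -> (L <= progress phase w i)%N ->
  (progress phase w i <= k < progress phase w i + L)%N -> phase k = odd j.
Proof.
move=> iL Lp /andP[pk kp]; apply: phaseE; rewrite -/L.
have := progress_le phase w i.
have L0 : (0 < L)%N by rewrite expn_gt0.
nia.
Qed.

(** Once progress reaches [L], the next [L] digits agree, which puts the point within 3^-L <= 1/L of
    0 or 1 and settles the comparison with [t]. The unfavourable event thus forces progress below
    [L]. *)
Lemma close_prob_phase c t j i (L := (2 ^ 2 ^ j)%N) :
  (forall L i, (0 < L)%N -> (c * L <= i)%N ->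
    (P [set w | (progress phase w i < L)%N] <= (L%:R^-1)%:E)%E) ->
  L%:R^-1 < t -> L%:R^-1 < 1 - t ->
  (c * L <= i < L * L.-1)%N ->
  (if odd j then a t i else 1 - a t i) <= L%:R^-1.
Proof.
move=> Hc Lt Lt' /andP[cLi iL].
have L0 : (0 < L)%N by rewrite expn_gt0.
have Lb : 3^-1 ^+ L <= L%:R^-1 :> R.
  rewrite exprVn lef_pV2 ?posrE ?exprn_gt0 ?ltr0n// -natrX ler_nat.
  by rewrite ltnW// ltn_expl.
have mE := @measurable_close R (@fun_f R) (@fun_g R) y0 0 i t.
have mN : measurable ([set w | (progress phase w i < L)%N] : set noise).
  exact: determined_measurable (@determined_progress phase i (fun N => (N < L)%N)).
rewrite -lee_fin; apply: le_trans (Hc L i L0 cLi).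
case: ifPn => oj.
  rewrite /a -close_probE; apply: le_measure; rewrite ?inE// close_eventE => w /= wt.
  rewrite ltnNge; apply/negP => Lp.
  have := @cantor_pt_near1 R phase L (progress phase w i).
  have W k := @phase_window j i w k iL Lp.
  move=> /(_ (fun k hk => etrans (W k hk) oj)); lra.
rewrite EFinB /a -close_probE -probability_setC//.
apply: le_measure; rewrite ?inE//; first exact: measurableC.
rewrite close_eventE => w /= wt; rewrite ltnNge; apply/negP => Lp; apply: wt.
have := @cantor_pt_near0 R phase L (progress phase w i).
have W k := @phase_window j i w k iL Lp.
move=> /(_ (fun k hk => etrans (W k hk) (negbTE oj))); lra.
Qed.

(* On block j, run the system for n = L (L - 1) steps, with L = 2^2^j: after the
   first c L steps the block has been entered with high probability, and it
   cannot have been left nor even approached, as progress grows by at most 1. *)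
Lemma mean_close_prob (t e : R) (b : bool) (n0 : nat) : 0 < t < 1 -> 0 < e ->
  exists2 n, (n0 < n)%N &
    n%:R^-1 * \sum_(i < n) (if b then a t i else 1 - a t i) <= e.
Proof.
move=> /andP[t0 t1] e0; have [c Hc] := progress_rate phase.
(* [L.-1] above [u] gives 1/L < t, 1/L < 1 - t and (c+1)/(L-1) <= e. *)
pose u := Num.max (t^-1) (Num.max ((1 - t)^-1) (c.+1%:R / e)).
have u0 : 0 <= u by rewrite le_max invr_ge0 ltW.
pose M := maxn n0.+1 (Num.bound u).
have uM : u < M%:R.
  by apply: (lt_le_trans (archi_boundP u0)); rewrite ler_nat leq_maxr.
(* Large, with parity [b]: a block of twos if [b] holds, of zeros otherwise. *)
pose j := (M.*2 + b)%N; pose L := (2 ^ 2 ^ j)%N.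
have oj : odd j = b by rewrite oddD odd_double; case: b @j @L.
have jL : (j.+1 < L)%N by apply: (@leq_ltn_trans (2 ^ j)); rewrite ltn_expl.
have ML : (M < L.-1)%N by rewrite /j in jL; lia.
have uL : u < L.-1%:R by rewrite (lt_trans uM)// ltr_nat.
have uL' : u < L%:R by rewrite (lt_le_trans uL)// ler_nat leq_pred.
have L0 : 0 < L%:R :> R by rewrite ltr0n; lia.
have L1 : 0 < L.-1%:R :> R by rewrite ltr0n; lia.
have Lt : L%:R^-1 < t.
  rewrite invf_plt ?posrE//; apply: le_lt_trans uL'.
  by rewrite /u le_max lexx.
have Lt' : L%:R^-1 < 1 - t.
  rewrite invf_plt ?posrE ?subr_gt0//; apply: le_lt_trans uL'.
  by rewrite /u !le_max lexx orbT.
exists (L * L.-1)%N.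
  apply: (@leq_trans M); first exact: leq_maxl.
  by apply: leq_trans (ltnW ML) _; rewrite leq_pmull// expn_gt0.
have := @mean_le R (fun i => if b then a t i else 1 - a t i) c L.
move=> H; apply: le_trans (H _ _ _) _.
- exact: leq_ltn_trans jL.
- move=> i; have /andP[] := close_prob01 (@fun_f R) (@fun_g R) p y0 0 t i.
  by rewrite -/(a t i); case: b {j oj L jL ML uL uL' L0 L1 Lt Lt' H} => ? ?; lra.
- by move=> i ci; rewrite -oj; apply: (close_prob_phase Hc).
rewrite ler_pdivrMr// mulrC -ler_pdivrMr//; apply: le_trans (ltW uL).
by rewrite /u !le_max lexx !orbT.
Qed.

(** Blocks of zeros give arbitrarily late times at which the mean of [a t] is at least 1 - e. *)
Lemma random_upper t : 0 < t < 1 ->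
  (1 <= upper_distribution (@fun_f R) (@fun_g R) p y0 0 t)%E.
Proof.
move=> t01; apply/lee_addgt0Pr => e e0; rewrite -leeBlDr//.
apply: limn_esup_ge => n0.
have [n n0n H] := mean_close_prob false n0 t01 e0.
exists n; first exact: ltnW.
rewrite distance_distributionE -EFinB lee_fin.
have n_gt0 : n%:R != 0 :> R by rewrite pnatr_eq0; lia.
move: H; rewrite /= sumrB sumr_const card_ord mulrBr mulVf//.
by rewrite -/(a t); lra.
Qed.

Lemma random_lower t : 0 < t < 1 ->
  (lower_distribution (@fun_f R) (@fun_g R) p y0 0 t <= 0)%E.
Proof.
move=> t01; apply/lee_addgt0Pr => e e0; rewrite add0e.
apply: limn_einf_le => n0.
have [n n0n H] := mean_close_prob true n0 t01 e0.
by exists n; [exact: ltnW|rewrite distance_distributionE lee_fin].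
Qed.

End random.

Theorem mainTheorem8 (R : realType) :
  (forall p : R, 0 < p < 1 ->
     measure_of_chaos (@fun_f R) (@fun_g R) p = 1%E) /\
  (forall p : R, p = 0 \/ p = 1 ->
     measure_of_chaos (@fun_f R) (@fun_g R) p = 0%E).
Proof.
split=> [p p01|p [->|->]].
- apply: (@measure_of_chaos_eq1 _ _ _ _ (cantor_pt R phase 0) 0).
  + exact: cantor_pt01.
  + by rewrite lexx ler01.
  + exact: random_upper.
  + exact: random_lower.
- exact: (measure_of_chaos_deterministic (b := false)) (@fun_g_eventually_fixed R).
- exact: (measure_of_chaos_deterministic (b := true)) (@fun_f_eventually_fixed R).
Qed.
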